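(* Let $\Gamma\cup\{\phi\}$ be a set of formulas in the language of $\mathbb{MPT}$ and $\sigma$ a classical substitution. If $\Gamma\models\phi$, then $\{\sigma(\gamma):\gamma\in\Gamma\}\models\sigma(\phi)$.
   Context: Variables $p_i$ ($i\in\mathbb N$); a valuation is $s:\mathbb N\to\{0,1\}$; a team is a set of valuations. Classical formulas: $\alpha::=p_i\mid\neg p_i\mid\bot\mid\alpha\wedge\alpha\mid\alpha\otimes\alpha$. Formulas of $\mathbb{MPT}$: $\phi::=p_i\mid\neg p_i\mid\neg\alpha\mid\top\mid\mathrm{NE}\mid\bot\mid\vec\alpha\perp\vec\beta\mid{=}(\vec\alpha,\beta)\mid\vec\alpha\subseteq\vec\beta\mid\phi\wedge\phi\mid\phi\otimes\phi\mid\phi\circledast\phi\mid\phi\vee\phi$, where $\alpha,\beta$ are classical formulas and $\vec\alpha=\alpha_1\dots\alpha_k$, $\vec\beta$ finite sequences of classical formulas (of equal length for $\subseteq$); in particular propositional variables may be used as arguments. For sequences $\vec\alpha,\vec\beta$ of length $k$ write $s\sim_{(\vec\alpha,\vec\beta)}s'$ iff for all $i\le k$ ($\{s\}\models\alpha_i\iff\{s'\}\models\beta_i$), and $\sim_{\vec\alpha}:=\sim_{(\vec\alpha,\vec\alpha)}$. Semantics: $X\models p_i$ iff $s(i)=1$ for all $s\in X$; $X\models\neg p_i$ iff $s(i)=0$ for all $s\in X$; $X\models\neg\alpha$ iff $\{s\}\not\models\alpha$ for all $s\in X$; $X\models\top$ always; $X\models\bot$ iff $X=\emptyset$; $X\models\mathrm{NE}$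 iff $X\ne\emptyset$; $X\models\vec\alpha\perp\vec\beta$ iff for all $s,s'\in X$ there is $s''\in X$ with $s\sim_{\vec\alpha}s''$ and $s'\sim_{\vec\beta}s''$; $X\models{=}(\vec\alpha,\beta)$ iff for all $s,s'\in X$, $s\sim_{\vec\alpha}s'$ implies $s\sim_\beta s'$; $X\models\vec\alpha\subseteq\vec\beta$ iff for all $s\in X$ there is $s'\in X$ with $s\sim_{(\vec\alpha,\vec\beta)}s'$; $X\models\phi\wedge\psi$ iff both; $X\models\phi\otimes\psi$ iff $X=Y\cup Z$ with $Y\models\phi$, $Z\models\psi$; $X\models\phi\circledast\psi$ iff $X=\emptyset$ or $X=Y\cup Z$ with $Y,Z$ nonempty, $Y\models\phi$, $Z\models\psi$; $X\models\phi\vee\psi$ iff $X\models\phi$ or $X\models\psi$. $\Gamma\models\phi$: every team satisfying all of $\Gamma$ satisfies $\phi$. A classical substitution is a map $\sigma$ assigning to each variable $p_i$ a classical formula $\sigma(p_i)$, extended to all $\mathbb{MPT}$-formulas by commuting with all connectives and atoms: $\sigma(\neg\alpha)=\neg\sigma(\alpha)$, $\sigma(\mathrm{NE})=\mathrm{NE}$, $\sigma(\bot)=\bot$, $\sigma(\top)=\top$, $\sigma(\vec\alpha\perp\vec\beta)=\sigma(\vec\alpha)\perp\sigma(\vec\beta)$, $\sigma({=}(\vec\alpha,\beta))={=}(\sigma(\vec\alpha),\sigma(\beta))$, $\sigma(\vec\alpha\subseteq\vec\beta)=\sigma(\vec\alpha)\subseteq\sigma(\vec\beta)$, $\sigma(\phi\circ\psi)=\sigma(\phi)\circ\sigma(\psi)$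 for $\circ\in\{\wedge,\otimes,\circledast,\vee\}$ (componentwise on sequences). *)

(* Defs.v *)
From mathcomp Require Import all_boot.
From mathcomp Require Import boolp classical_sets.

Set Implicit Arguments.
Unset Strict Implicit.
Unset Printing Implicit Defensive.

Local Open Scope classical_set_scope.

Definition valuation := nat -> bool.
Definition team := set valuation.

(* The paper's classical formulas only negate variables (predicate [classical]
   below), but sigma(~ p_i) = ~ sigma(p_i) may occur inside a negation or an
   atom.  The ambient syntax of arguments is therefore closed under negation,
   so that substitution can commute literally with every constructor; the
   formula [~ p_i] is [CNeg (CVar i)]. *)
Inductive cform : Type :=
| CVar (i : nat)
| CNeg (a : cform)
| CBot
| CAnd (a b : cform)
| COtimes (a b : cform).

Fixpoint classical (a : cform) : bool :=
  match a with
  | CVar _ => true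
  | CNeg (CVar _) => true
  | CNeg _ => false
  | CBot => true
  | CAnd a b | COtimes a b => classical a && classical b
  end.

(* [FOstar] is the circled asterisk, [FVee] the global disjunction.  Sequences
   may be empty; the two sequences of [FIncl] have equal length by typing.
   [FNeg (CVar i)] is the literal [~ p_i]. *)
Inductive form : Type :=
| FVar (i : nat)
| FNeg (a : cform)
| FTop
| FNE
| FBot
| FIndep (k l : nat) (a : k.-tuple cform) (b : l.-tuple cform)
| FDep (k : nat) (a : k.-tuple cform) (b : cform)
| FIncl (k : nat) (a b : k.-tuple cform)
| FAnd (f g : form)
| FOtimes (f g : form)
| FOstar (f g : form)
| FVee (f g : form).

Fixpoint mpt (f : form) : bool :=
  match f with
  | FVar _ | FTop | FNE | FBot => true
  | FNeg a => classical a
  | FIndep _ _ a b => all classical a && all classical b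
  | FDep _ a b => all classical a && classical b
  | FIncl _ a b => all classical a && all classical b
  | FAnd f g | FOtimes f g | FOstar f g | FVee f g => mpt f && mpt g
  end.

Fixpoint form_of_cform (a : cform) : form :=
  match a with
  | CVar i => FVar i
  | CNeg a => FNeg a
  | CBot => FBot
  | CAnd a b => FAnd (form_of_cform a) (form_of_cform b)
  | COtimes a b => FOtimes (form_of_cform a) (form_of_cform b)
  end.

(* Restriction of [sat] to arguments; see [sat_form_of_cform]. *)
Fixpoint csat (X : team) (a : cform) : Prop :=
  match a with
  | CVar i => forall s, X s -> s i = true
  | CNeg a => forall s, X s -> ~ csat [set s] a
  | CBot => X = set0
  | CAnd a b => csat X a /\ csat X b
  | COtimes a b => exists Y Z : team, [/\ X = Y `|` Z, csat Y a & csat Z b]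
  end.

Definition sim2 (k : nat) (a b : k.-tuple cform) (s s' : valuation) : Prop :=
  forall i : 'I_k, csat [set s] (tnth a i) <-> csat [set s'] (tnth b i).

Definition sim (k : nat) (a : k.-tuple cform) : valuation -> valuation -> Prop :=
  sim2 a a.

Fixpoint sat (X : team) (f : form) : Prop :=
  match f with
  | FVar i => forall s, X s -> s i = true
  | FNeg a => forall s, X s -> ~ csat [set s] a
  | FTop => True
  | FNE => X !=set0
  | FBot => X = set0
  | FIndep _ _ a b => forall s s', X s -> X s' ->
      exists s'', [/\ X s'', sim a s s'' & sim b s' s'']
  | FDep _ a b => forall s s', X s -> X s' -> sim a s s' -> sim [tuple b] s s'
  | FIncl _ a b => forall s, X s -> exists s', X s' /\ sim2 a b s s'
  | FAnd f g => sat X f /\ sat X g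
  | FOtimes f g => exists Y Z : team, [/\ X = Y `|` Z, sat Y f & sat Z g]
  | FOstar f g => X = set0 \/
      exists Y Z : team,
        [/\ X = Y `|` Z, Y !=set0, Z !=set0, sat Y f & sat Z g]
  | FVee f g => sat X f \/ sat X g
  end.

Lemma sat_form_of_cform (a : cform) (X : team) :
  sat X (form_of_cform a) <-> csat X a.
Proof.
elim: a X => [i|a _||a IHa b IHb|a IHa b IHb] X //=; first by rewrite IHa IHb.
by split=> -[Y [Z [-> /IHa HY /IHb HZ]]]; exists Y, Z.
Qed.

Lemma sat_negvar (i : nat) (X : team) :
  sat X (FNeg (CVar i)) <-> (forall s, X s -> s i = false).
Proof.
split=> /= H s Xs; last by move/(_ s erefl); rewrite H.
by apply/negP => si; apply: (H s Xs) => _ ->.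
Qed.

Definition entails (Gamma : set form) (f : form) : Prop :=
  forall X : team, (forall g, Gamma g -> sat X g) -> sat X f.

Definition csubst := nat -> cform.

Definition classical_subst (sigma : csubst) : Prop :=
  forall i, classical (sigma i).

Fixpoint subst_cform (sigma : csubst) (a : cform) : cform :=
  match a with
  | CVar i => sigma i
  | CNeg a => CNeg (subst_cform sigma a)
  | CBot => CBot
  | CAnd a b => CAnd (subst_cform sigma a) (subst_cform sigma b)
  | COtimes a b => COtimes (subst_cform sigma a) (subst_cform sigma b)
  end.

Definition subst_seq (sigma : csubst) (k : nat) (a : k.-tuple cform) :
  k.-tuple cform := [tuple of map (subst_cform sigma) a].

Fixpoint subst (sigma : csubst) (f : form) : form :=
  match f with
  | FVar i => form_of_cform (sigma i)
  | FNeg a => FNeg (subst_cform sigma a)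
  | FTop => FTop
  | FNE => FNE
  | FBot => FBot
  | FIndep _ _ a b => FIndep (subst_seq sigma a) (subst_seq sigma b)
  | FDep _ a b => FDep (subst_seq sigma a) (subst_cform sigma b)
  | FIncl _ a b => FIncl (subst_seq sigma a) (subst_seq sigma b)
  | FAnd f g => FAnd (subst sigma f) (subst sigma g)
  | FOtimes f g => FOtimes (subst sigma f) (subst sigma g)
  | FOstar f g => FOstar (subst sigma f) (subst sigma g)
  | FVee f g => FVee (subst sigma f) (subst sigma g)
  end.

(* Main.v *)
Require Import Defs.
From mathcomp Require Import all_boot.
From mathcomp Require Import boolp classical_sets.

Local Open Scope classical_set_scope.

(** Classical formulas are flat, so a substitution [sigma] acts on valuations:
    [sigma^*(s)] makes [p_i] true iff [{s}] satisfies [sigma(p_i)].  A team [X]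
    satisfies [sigma(phi)] iff the image team [sigma^*(X)] satisfies [phi], and
    the theorem follows by applying the entailment to [sigma^*(X)]. *)

(** Induction on [a] for all teams at once. Only [COtimes] needs thought: pointwise truth has to be
    assembled into one split of [X]. *)
Lemma csat_flat (X : team) (a : cform) :
  csat X a <-> forall s, X s -> csat [set s] a.
Proof.
elim: a X => [i|a _||a IHa b IHb|a IHa b IHb] X /=.
- split=> [H s Xs _ -> | H s Xs]; first exact: H.
  exact: (H s Xs s).
- split=> [H s Xs _ -> | H s Xs]; first exact: H.
  exact: (H s Xs s).
- split=> [-> s [] | H].
  by rewrite -subset0 => s /H /seteqP[/(_ s erefl)].
- rewrite IHa IHb; split=> [[Ha Hb] s Xs | H].
    by split; [exact: Ha|exact: Hb].
  by split=> s /H[].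
- split=> [[Y [Z [-> /IHa HY /IHb HZ]]] s [Ys|Zs] | H].
  (* The empty part satisfies its formula, since the induction hypothesis is vacuous there. *)
  + exists [set s], set0; split; [by rewrite setU0|exact: HY|].
    by apply/IHb => ? [].
  + exists set0, [set s]; split; [by rewrite set0U| |exact: HZ].
    by apply/IHa => ? [].
  (* The largest possible parts; they may overlap. They cover [X] because every split of a singleton
     puts its point in one of the halves. *)
  exists [set s | X s /\ csat [set s] a], [set s | X s /\ csat [set s] b].
  split; [|by apply/IHa => s []|by apply/IHb => s []].
  apply/seteqP; split=> [s Xs | s [[]|[]] //].
  have [Y [Z [E /IHa HY /IHb HZ]]] := H s Xs.
  have : (Y `|` Z) s by rewrite -E.
  by case=> [/HY|/HZ] ?; [left|right].
Qed.

Lemma csat1_otimes (s : valuation) (a b : cform) :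
  csat [set s] (COtimes a b) <-> csat [set s] a \/ csat [set s] b.
Proof.
split=> [[Y [Z [E /csat_flat HY /csat_flat HZ]]] | H].
  have : (Y `|` Z) s by rewrite -E.
  by case=> [/HY|/HZ]; [left|right].
case: H => H; [exists [set s], set0|exists set0, [set s]];
  by split=> //; rewrite ?setU0 ?set0U //; apply/csat_flat => ? [].
Qed.

Definition pull_valuation (sigma : csubst) (s : valuation) : valuation :=
  fun i => `[< csat [set s] (sigma i) >].

(** On singletons the connectives are Boolean, [COtimes] being disjunction, so this is the usual
    substitution lemma of propositional logic. *)
Lemma csat_subst1 (sigma : csubst) (s : valuation) (a : cform) :
  csat [set s] (subst_cform sigma a) <-> csat [set pull_valuation sigma s] a.
Proof.
elim: a => [i|a IH||a IHa b IHb|a IHa b IHb].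
- split=> [H _ -> | /(_ _ erefl)/asboolP //].
  exact/asboolP.
- by split=> H _ -> /IH; exact: H.
- by split=> /seteqP[/(_ _ erefl)].
- by rewrite /= IHa IHb.
- by rewrite [subst_cform _ _]/= !csat1_otimes IHa IHb.
Qed.

Lemma sim2_subst (sigma : csubst) (k : nat) (a b : k.-tuple cform)
    (s s' : valuation) :
  sim2 (subst_seq sigma a) (subst_seq sigma b) s s' <->
  sim2 a b (pull_valuation sigma s) (pull_valuation sigma s').
Proof.
by split=> H i; move: (H i); rewrite !tnth_map !csat_subst1.
Qed.

(** Needed besides [sim2_subst] because [subst] rebuilds the one-entry tuple of a dependence atom
    instead of applying [subst_seq] to it. *)
Lemma sim_subst1 (sigma : csubst) (b : cform) (s s' : valuation) :
  sim [tuple subst_cform sigma b] s s' <->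
  sim [tuple b] (pull_valuation sigma s) (pull_valuation sigma s').
Proof.
by split=> H i; move: (H i); rewrite ord1 /= !csat_subst1.
Qed.

(** Lifts a split of the image team to a split of [X]. Each part lies inside the image of [X], so
    its preimage within [X] maps onto it. *)
Lemma image_eq_setU {A B : Type} (f : A -> B) (X : set A) (Y Z : set B) :
  f @` X = Y `|` Z ->
  [/\ X = (X `&` f @^-1` Y) `|` (X `&` f @^-1` Z),
      f @` (X `&` f @^-1` Y) = Y & f @` (X `&` f @^-1` Z) = Z].
Proof.
move=> E.
have surj (W : set B) : W `<=` Y `|` Z -> f @` (X `&` f @^-1` W) = W.
  move=> sub; apply/seteqP; split=> [_ [x [_ Wx] <-] //|y Wy].
  have : (f @` X) y by rewrite E; exact: sub.
  by case=> x Xx fx; exists x => //; split=> //=; rewrite fx.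
split; [|exact/surj/subsetUl|exact/surj/subsetUr].
(* The union of the lifted parts is [X] intersected with the preimage of its own image. *)
rewrite -setIUr -preimage_setU -E; apply/seteqP; split=> [x Xx|x []//].
by split=> //; exists x.
Qed.

(** Witnesses in the image come from points of [X], and the [sim] relations transfer in both
    directions. Splits of [X] map forward by [image_setU] and come back by [image_eq_setU]. *)
Lemma sat_subst (sigma : csubst) (f : form) (X : team) :
  sat X (subst sigma f) <-> sat (pull_valuation sigma @` X) f.
Proof.
elim: f X => [i|a||||k l a b|k a b|k a b|f IHf g IHg|f IHf g IHg
  |f IHf g IHg|f IHf g IHg] X //=.
(* Flatness reduces [sigma i] to singletons, where its truth defines [pull_valuation]. *)
- rewrite sat_form_of_cform csat_flat.
  split=> [H _ [s Xs <-]|H s Xs]; first exact/asboolP/H.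
  by apply/asboolP/(H (pull_valuation sigma s)); exists s.
- split=> [H _ [s Xs <-] /csat_subst1|H s Xs /csat_subst1]; first exact: H.
  by apply: H; exists s.
- by split=> [[s Xs]|[_ [s Xs _]]]; [exists (pull_valuation sigma s), s|exists s].
- by split=> [->|/image_set0_set0]; first exact: image_set0.
- split=> [H _ _ [s Xs <-] [s' Xs' <-]|H s s' Xs Xs'].
    have [t [Xt /sim2_subst st /sim2_subst s't]] := H s s' Xs Xs'.
    by exists (pull_valuation sigma t); split=> //; exists t.
  have [||_ [[t Xt <-] /sim2_subst st /sim2_subst s't]] :=
    H (pull_valuation sigma s) (pull_valuation sigma s');
    [by exists s|by exists s'|by exists t].
- split=> [H _ _ [s Xs <-] [s' Xs' <-] /sim2_subst ss'|H s s' Xs Xs' /sim2_subst ss'].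
    exact/sim_subst1/H.
  by apply/sim_subst1/H => //; [exists s|exists s'].
- split=> [H _ [s Xs <-]|H s Xs].
    have [t [Xt /sim2_subst st]] := H s Xs.
    by exists (pull_valuation sigma t); split=> //; exists t.
  have [|_ [[t Xt <-] /sim2_subst st]] := H (pull_valuation sigma s);
    [by exists s|by exists t].
- by rewrite IHf IHg.
- split=> [[Y [Z [-> /IHf HY /IHg HZ]]]|[Y [Z [E HY HZ]]]].
    by do 2 eexists; split; [exact: image_setU|exact: HY|exact: HZ].
  have [EX EY EZ] := image_eq_setU _ _ _ _ E.
  by do 2 eexists; split; [exact: EX|apply/IHf; rewrite EY|apply/IHg; rewrite EZ].
- split=> [[->|[Y [Z [-> Y0 Z0 /IHf HY /IHg HZ]]]]|
           [/image_set0_set0|[Y [Z [E Y0 Z0 HY HZ]]]]]; [|right|by left|right].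
  + by left; rewrite image_set0.
  + do 2 eexists; split; [exact: image_setU|exact/image_nonempty
      |exact/image_nonempty|exact: HY|exact: HZ].
  have [EX EY EZ] := image_eq_setU _ _ _ _ E.
  (* A lifted part is nonempty because its image is. *)
  do 2 eexists; split; [exact: EX| | |apply/IHf; rewrite EY //|apply/IHg; rewrite EZ //].
  + by apply: (@nonempty_image _ _ (pull_valuation sigma)); rewrite EY.
  + by apply: (@nonempty_image _ _ (pull_valuation sigma)); rewrite EZ.
- by rewrite IHf IHg.
Qed.

Theorem theorem4p3 (Gamma : set form) (phi : form) (sigma : csubst)
    (hGamma : forall g, Gamma g -> mpt g) (hphi : mpt phi)
    (hsigma : classical_subst sigma) :
  entails Gamma phi -> entails (subst sigma @` Gamma) (subst sigma phi).
Proof.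
move=> ent X HX; apply/sat_subst/ent => g Gg.
by apply/sat_subst/HX; exists g.
Qed.
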